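(* Let $A\in\mathbb{R}^{n\times n}$ be stable and $b\in\mathbb{R}^n$. Let $\Lambda\in\mathbb{C}^{s\times s}$ and $\beta\in\mathbb{R}^s$ with all entries of $\beta$ positive satisfy $$\operatorname{diag}(\beta)\overline{\Lambda}+\Lambda^{\mathsf T}\operatorname{diag}(\beta)-\beta\beta^{\mathsf T}=0,$$ and let the eigenvalues $\mu_1,\ldots,\mu_s$ of $\Lambda$ (listed with algebraic multiplicity, in any order) all have positive real part. Then the matrices $-\overline{\Lambda}$ and $\Lambda-\mathds{1}_s\beta^{\mathsf T}$ are similar, where $\mathds{1}_s=(1,\ldots,1)^{\mathsf T}\in\mathbb{R}^s$. Moreover, the $s$-stage Runge-Kutta step with tableau $(\Lambda,\beta)$ and time step size $1$ is equivalent to the $s$-stage Runge-Kutta step with time step size $1$ and the DIRK tableau $(\Lambda_D,\beta_D)$, where $\Lambda_D\in\mathbb{C}^{s\times s}$ is the lower triangular matrix with diagonal entries $(\Lambda_D)_{ii}=\mu_i$ and strictly lower triangular entries $(\Lambda_D)_{i\ell}=2\operatorname{Re}(\mu_\ell)$ for $\ell<i$, and $\beta_D=(2\operatorname{Re}(\mu_1),\ldots,2\operatorname{Re}(\mu_s))^{\mathsf T}$; and therefore it is equivalent to $s$ steps with the $1$-stage tableaus $\Lambda^{(j)}=\mu_j$, $\beta^{(j)}=2\operatorname{Re}(\mu_j)$, $j=1,\ldots,s$, i.e. to $s$ steps of the $1$-stage Runge-Kutta iteration with parameters $\mu_1,\ldots,\mu_s$. Here equivalent means that the procedures produce the same final approximation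 $ZZ^{\mathsf H}$ and the same final vector $h$.
   Context: A real square matrix is stable if all its eigenvalues have negative real part. $\overline{X}$ is the entrywise complex conjugate, $X^{\mathsf T}$ the transpose and $X^{\mathsf H}$ the conjugate transpose. All procedures approximate the solution $\mathcal{P}$ of $A\mathcal{P}+\mathcal{P}A^{\mathsf T}+bb^{\mathsf T}=0$ by $ZZ^{\mathsf H}$. $s$-stage Runge-Kutta step with tableau $(\Lambda,\beta)$, $\beta$ having positive entries, and time step size $1$: with $h_0=b$, let $K\in\mathbb{C}^{n\times s}$ be the solution of $K=[Ah_0,\ldots,Ah_0]+AK\Lambda^{\mathsf T}$ (the vector $Ah_0$ is repeated $s$ times; the solution is unique because no eigenvalue of $\Lambda$ is the inverse of an eigenvalue of $A$); $\mathcal{H}=[h_0,\ldots,h_0]+K\Lambda^{\mathsf T}$; $Z=\mathcal{H}\operatorname{diag}(\sqrt{\beta_1},\ldots,\sqrt{\beta_s})$; final vector $h=h_0+K\beta$. $1$-stage Runge-Kutta iteration with parameters $\mu_1,\ldots,\mu_s$: set $h_0=b$ and let $Z_0$ be the empty matrix. For $j=1,\ldots,s$: let $K_j\in\mathbb{C}^{n}$ be the solution of $(I_n-\mu_jA)K_j=Ah_{j-1}$; $\mathcal{H}_j=h_{j-1}+\mu_jK_j$; $Z_j=[Z_{j-1},\ \sqrt{2\operatorname{Re}(\mu_j)}\,\mathcal{H}_j]$; $h_j=h_{j-1}+2\operatorname{Re}(\mu_j)K_j$. Final: $Z=Z_s$, $h=h_s$. *)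

(* Defs.v *)
From HB Require Import structures.
From mathcomp Require Import all_boot all_order all_algebra.
From mathcomp Require Import reals complex.

Set Implicit Arguments.
Unset Strict Implicit.
Unset Printing Implicit Defensive.

Import Order.TTheory GRing.Theory Num.Theory.

Local Open Scope ring_scope.
Local Open Scope complex_scope.

Section RungeKutta.
Variable R : realType.

Definition cplxmx m n (M : 'M[R]_(m, n)) : 'M[R[i]]_(m, n) :=
  map_mx (real_complex R) M.

Definition conjmatrix m n (M : 'M[R[i]]_(m, n)) : 'M[R[i]]_(m, n) :=
  map_mx conjc M.

Definition stable n (A : 'M[R]_n) : Prop :=
  forall z : R[i], eigenvalue (cplxmx A) z -> complex.Re z < 0.

Definition repeat_col n s (v : 'cV[R[i]]_n) : 'M[R[i]]_(n, s) :=
  \matrix_(i, j) v i 0.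

(* A procedure is given by its input-output relation: P Z h says that Z and h
   are its final factor and final vector. *)

(* The linear systems defining the stages must be uniquely solvable for a step
   to have an output at all; this is what `unique` records. *)
Definition rk_step n s (A : 'M[R[i]]_n) (L : 'M[R[i]]_s) (beta : 'cV[R]_s)
    (h0 : 'cV[R[i]]_n) (Z : 'M[R[i]]_(n, s)) (h : 'cV[R[i]]_n) : Prop :=
  exists K : 'M[R[i]]_(n, s),
    [/\ unique (fun K => K = repeat_col s (A *m h0) + A *m K *m L^T) K,
        Z = (repeat_col s h0 + K *m L^T)
              *m diag_mx (\row_j (Num.sqrt (beta j 0))%:C)
      & h = h0 + K *m cplxmx beta].

(* Z_0 is empty, Z_(j+1) = [Z_j, z_j], h_0 is the starting vector, and the
   j-th step (counting from 0) maps h_j to the column z_j and to h_(j+1).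
   No condition on Z_0 is needed: it is the only n x 0 matrix. *)
Definition iterate_steps n s
    (step : 'I_s -> 'cV[R[i]]_n -> 'cV[R[i]]_n -> 'cV[R[i]]_n -> Prop)
    (h0 : 'cV[R[i]]_n) (Z : 'M[R[i]]_(n, s)) (h : 'cV[R[i]]_n) : Prop :=
  exists (Zs : forall j : nat, 'M[R[i]]_(n, j)) (hs : nat -> 'cV[R[i]]_n),
    [/\ hs 0%N = h0,
        forall j : 'I_s, exists z : 'cV[R[i]]_n,
          step j (hs j) z (hs j.+1) /\
          Zs j.+1 = castmx (erefl n, addn1 j) (row_mx (Zs j) z),
        Z = Zs s
      & h = hs s].

Definition rk_one_stage_steps n s (A : 'M[R[i]]_n) (mu : 'I_s -> R[i]) :=
  iterate_steps (fun j : 'I_s =>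
    rk_step A (mu j)%:M (const_mx (2 * complex.Re (mu j)) : 'cV[R]_1)).

Definition rk_one_stage_iteration n s (A : 'M[R[i]]_n) (mu : 'I_s -> R[i]) :=
  iterate_steps (fun (j : 'I_s) (h0 z h : 'cV[R[i]]_n) =>
    exists K : 'cV[R[i]]_n,
      [/\ unique (fun K => (1%:M - mu j *: A) *m K = A *m h0) K,
          z = (Num.sqrt (2 * complex.Re (mu j)))%:C *: (h0 + mu j *: K)
        & h = h0 + (2 * complex.Re (mu j))%:C *: K]).

Definition dirk_matrix s (mu : 'I_s -> R[i]) : 'M[R[i]]_s :=
  \matrix_(i, l) if i == l then mu i
                 else if (l < i)%N then (2 * complex.Re (mu l))%:C else 0.

Definition dirk_weights s (mu : 'I_s -> R[i]) : 'cV[R]_s :=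
  \col_i (2 * complex.Re (mu i)).

(* Both procedures have an output, and all their outputs agree. *)
Definition equivalent_procedures n s t
    (P : 'M[R[i]]_(n, s) -> 'cV[R[i]]_n -> Prop)
    (Q : 'M[R[i]]_(n, t) -> 'cV[R[i]]_n -> Prop) : Prop :=
  [/\ exists Z h, P Z h,
      exists Z h, Q Z h
    & forall Z h Z' h', P Z h -> Q Z' h' ->
        Z *m (conjmatrix Z)^T = Z' *m (conjmatrix Z')^T /\ h = h'].

End RungeKutta.

(* Main.v *)
(* Scale the tableau to M = W L W^-1 with W = diag(sqrt beta). The condition on
   (L, beta) then reads M + M^H = w w^T with w = sqrt beta. A Schur form
   T = U M U^H that is lower triangular with diagonal mu, in the given order,
   satisfies T + T^H = u u^H with u = U w. Hence |u_j|^2 = 2 Re(mu_j), and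
   T_il = u_i conj(u_l) for l < i, so that S = diag(u)^-1 U W conjugates L into
   the DIRK matrix, fixes the all-ones vector, and carries the quadratic form
   diag(beta_D) back to diag(beta). The stages of the two tableaus differ by
   S^T, which leaves Z Z^H and h unchanged, and column j of the DIRK stage
   equation is the j-th one-stage step.

   Since the order of mu is arbitrary, L is also similar to the DIRK matrix of
   the reversed list, which is similar to the transpose of the DIRK matrix of
   mu; so L is similar to L^T. With D = diag(beta), the condition gives
   L - 1 beta^T = - D^-1 L^H D, which is therefore similar to - conj(L). *)

Require Import Defs.
From HB Require Import structures.
From mathcomp Require Import all_boot all_order all_algebra.
From mathcomp Require Import reals complex ring zify.
Set Implicit Arguments.
Unset Strict Implicit.
Unset Printing Implicit Defensive.
Import Order.TTheory GRing.Theory Num.Theory.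
Local Open Scope ring_scope.
Local Open Scope sesquilinear_scope.

(** * Unitary triangularization with a prescribed order of the eigenvalues *)

Lemma char_poly_lblock (F : comNzRingType) (m n : nat) (A : 'M[F]_m) (B : 'M[F]_(n, m))
    (D : 'M[F]_n) :
  char_poly (block_mx A 0 B D) = char_poly A * char_poly D.
Proof.
rewrite /char_poly /char_poly_mx map_block_mx scalar_mx_block.
by rewrite opp_block_mx add_block_mx map_mx0 subr0 det_lblock.
Qed.

Lemma char_poly_conj (F : comUnitRingType) (n : nat) (P A : 'M[F]_n) :
  P \in unitmx -> char_poly (P *m A *m invmx P) = char_poly A.
Proof.
move=> Pu; have PVP : map_mx polyC P *m map_mx polyC (invmx P) = 1%:M.
  by rewrite -map_mxM mulmxV // map_mx1.
rewrite /char_poly /char_poly_mx.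
have -> : 'X%:M - map_mx polyC (P *m A *m invmx P)
  = map_mx polyC P *m ('X%:M - map_mx polyC A) *m map_mx polyC (invmx P).
  by rewrite mulmxBr mulmxBl !map_mxM scalar_mxC -(mulmxA 'X%:M) PVP mulmx1.
by rewrite !det_mulmx mulrAC -det_mulmx PVP det1 mul1r.
Qed.

Lemma unitary_left_eigenvector (C : numClosedFieldType) (n : nat)
    (M : 'M[C]_n.+1) (a : C) :
  eigenvalue M a ->
  exists2 V : 'M[C]_n.+1, V \is unitarymx & row 0 V *m M = a *: row 0 V.
Proof.
case/eigenvalueP=> v Mv v0.
have rkv : \rank v = 1%N.
  by apply/eqP; rewrite eqn_leq rank_leq_row lt0n mxrank_eq0.
(* As [v] has rank 1, the first row of [row_ebase v] spans the same line, and Gram-Schmidt keeps the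
   span of the first row. *)
exists (schmidt (row_ebase v)); first exact: schmidt_unitarymx.
apply/eigenspaceP.
have vV : (v <= row 0 (schmidt (row_ebase v)))%MS.
  apply: submx_trans (_ : v <= row 0 (row_ebase v))%MS _.
    rewrite -{1}(mulmx_ebase v) (mx11_scalar (col_ebase v)) -mulmxA mul_scalar_mx.
    apply: scalemx_sub; rewrite rkv.
    rewrite rowE; apply: submxMr; rewrite (_ : pid_mx 1 = delta_mx 0 0) //.
    by apply/matrixP=> i j; rewrite !mxE !ord1 /= andbT (eq_sym 0%N).
  apply: submx_trans (row_schmidt_sub _ _) _.
  apply/sumsmx_subP => k; rewrite leqn0 => /eqP k0.
  by rewrite genmxE (_ : k = 0) //; apply: val_inj.
(* A row has rank at most 1, so the inclusion [vV] is an equality of lines. *)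
have: (row 0 (schmidt (row_ebase v)) <= v)%MS.
  by rewrite -(geq_leqif (mxrank_leqif_sup vV)) rkv rank_leq_row.
by move/submx_trans; apply; apply/eigenspaceP.
Qed.

(** Deflation by a left eigenvector for [mu ord0]: in a unitary basis starting with it, the first
    row is [mu ord0] followed by zeros, hence a lower triangular form. Each step may choose any
    remaining eigenvalue, so the order is free. *)
Lemma ordered_Schur (C : numClosedFieldType) (s : nat) (M : 'M[C]_s) (mu : 'I_s -> C) :
  char_poly M = \prod_j ('X - (mu j)%:P) ->
  exists2 U : 'M[C]_s, U \is unitarymx &
    is_trig_mx (U *m M *m U^t*) /\ forall i, (U *m M *m U^t*) i i = mu i.
Proof.
elim: s => [|s IHs] in M mu *.
  move=> _; exists 1%:M; first by apply/unitarymxP; apply/matrixP => -[].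
  by split=> [|[]//]; apply/is_trig_mxP => -[].
rewrite big_ord_recl => chiM.
have [|V Vu V0] := @unitary_left_eigenvector C s M (mu ord0).
  by rewrite eigenvalue_root_char chiM rootM root_XsubC eqxx.
(* N is kept opaque, otherwise mxE would expand its entries. *)
have [N defN] : {N : 'M[C]_(1 + s) | N = V *m M *m V^t*}.
  by exists (V *m M *m V^t*).
have Nur : ursubmx N = 0 /\ ulsubmx N = (mu ord0)%:M.
  have row0N : row 0 N = mu ord0 *: row 0 1%:M.
    by rewrite defN !row_mul V0 -scalemxAl -row_mul (unitarymxP Vu).
  split; apply/matrixP => i j; rewrite !ord1 !mxE.
    rewrite (lshift0 s 0).
    by move/rowP/(_ (rshift 1 j)): row0N; rewrite !mxE mulr0.
  by move/rowP/(_ 0): row0N; rewrite !mxE (lshift0 s 0) mulr1.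
have NE : N = block_mx (mu ord0)%:M 0 (dlsubmx N) (drsubmx N).
  by rewrite -{1}(submxK N) Nur.1 Nur.2.
have chiN : char_poly N = char_poly M.
  by rewrite defN -invmx_unitary // char_poly_conj // unitarymx_unit.
have [|U' U'u [trigU' diagU']] := IHs (drsubmx N) (fun j => mu (lift ord0 j)).
  (* Cancelling the factor of [mu ord0] leaves the characteristic polynomial of the lower right
     block. *)
  apply: (mulfI (negbT (polyXsubC_eq0 (mu ord0)))).
  rewrite -chiM -chiN NE char_poly_lblock block_mxKdr; congr (_ * _).
  by rewrite char_poly_trig ?scalar_mx_is_trig // big_ord1 mxE.
pose U : 'M[C]_(1 + s) := block_mx 1%:M 0 0 U'.
have Utc : U^t* = block_mx 1%:M 0 0 (U'^t*).
  by rewrite /U tr_block_mx map_block_mx !trmx0 !map_mx0 trmx1 map_mx1.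
have Uu : U \is unitarymx.
  apply/unitarymxP; rewrite Utc mulmx_block !mulmx0 !mul0mx mul1mx addr0 add0r.
  rewrite (unitarymxP U'u) ?addr0 ?add0r. by rewrite -scalar_mx_block.
exists (U *m V); first exact: mul_unitarymx.
have -> : U *m V *m M *m (U *m V)^t* =
    block_mx (mu ord0)%:M 0 (U' *m dlsubmx N) (U' *m drsubmx N *m U'^t*).
  rewrite trmx_mul map_mxM !mulmxA -(mulmxA (U *m V)) -(mulmxA U) -(mulmxA U).
  rewrite (mulmxA V) -defN NE Utc !mulmx_block.
  rewrite !(mulmx1, mul1mx, mulmx0, mul0mx, addr0, add0r).
  by rewrite block_mxKdl block_mxKdr mulmxA.
split.
  rewrite (@is_trig_block_mx _ 1 s 1 s) // eqxx trigU' andbT /=.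
  exact: scalar_mx_is_trig.
move=> i; rewrite -(splitK (i : 'I_(1 + s))); case: (split _) => j /=.
  apply: etrans (block_mxEul _ _ _ _ _ _) _.
  by rewrite ord1 mxE eqxx mulr1n; congr mu; apply: val_inj.
apply: etrans (block_mxEdr _ _ _ _ _ _) _.
by rewrite diagU'; congr mu; apply: val_inj.
Qed.

(** * Similarity between the given tableau and the DIRK tableau *)

Local Open Scope complex_scope.

Lemma diag_mx_unit (F : fieldType) (s : nat) (d : 'rV[F]_s) :
  (forall i, d 0 i != 0) -> diag_mx d \in unitmx.
Proof.
by move=> d0; rewrite unitmxE det_diag unitfE; apply/prodf_neq0 => i _.
Qed.

Lemma dirk_similarity (R : realType) (s : nat) (L : 'M[R[i]]_s) (beta : 'cV[R]_s)
    (mu : 'I_s -> R[i]) :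
  (forall j, 0 < beta j 0) ->
  diag_mx (cplxmx beta)^T *m conjmatrix L + L^T *m diag_mx (cplxmx beta)^T
    - cplxmx beta *m (cplxmx beta)^T = 0 ->
  char_poly L = \prod_j ('X - (mu j)%:P) ->
  (forall j, 0 < complex.Re (mu j)) ->
  exists S : 'M[R[i]]_s,
    [/\ S \in unitmx, S *m L = dirk_matrix mu *m S,
        S *m (const_mx 1 : 'cV_s) = const_mx 1
      & (conjmatrix S)^T *m diag_mx (cplxmx (dirk_weights mu))^T *m S
        = diag_mx (cplxmx beta)^T].
Proof.
move=> beta_gt0 L_beta chiL mu_gt0.
(* [r j] is the square root of [beta j 0], kept abstract behind these three facts. *)
have [r [r_neq0 r_conj r_sqr]] : exists r : 'I_s -> R[i],
    [/\ forall j, r j != 0, forall j, (r j)^*%R = r j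
      & forall j, r j * r j = (beta j 0)%:C].
  exists (fun j => (Num.sqrt (beta j 0))%:C); split=> j.
  - by rewrite (fmorph_eq0 (real_complex R)) sqrtr_eq0 -ltNge.
  - exact: conjc_real.
  - by rewrite -rmorphM -expr2 sqr_sqrtr // ltW.
pose W := diag_mx (\row_j r j).
have W_unit : W \in unitmx by apply: diag_mx_unit => j; rewrite mxE.
pose M := \matrix_(i, j) (r i * L i j / r j).
have MW : M *m W = W *m L.
  by apply/matrixP=> i j; rewrite mul_mx_diag mul_diag_mx !mxE divfK.
have chiM : char_poly M = \prod_j ('X - (mu j)%:P).
  by rewrite -chiL -(char_poly_conj L W_unit) -MW mulmxK.
have [U U_unitary] := ordered_Schur chiM.
have UKtV (X : 'M[R[i]]_s) : X *m U^t* *m U = X by apply: mulmxKtV.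
have [T defT] : {T | T = U *m M *m U^t*} by exists (U *m M *m U^t*).
rewrite -defT => -[T_trig T_diag].
pose w := \col_j r j.
have [u defu] : {u | u = U *m w} by exists (U *m w).
have M_lyap : M + M^t* = w *m w^t*.
  apply/matrixP=> i j; rewrite !mxE big_ord1 !mxE.
  have /matrixP/(_ i j) := L_beta.
  rewrite mul_diag_mx mul_mx_diag !mxE big_ord1 !mxE -!r_sqr.
  rewrite -[conjc _]/((L i j)^*)%R.
  (* The hypothesis has the conjugate on [L i j], the goal on [L j i]; conjugating and then clearing
     [r i] and [r j] makes them match. *)
  move=> /eqP; rewrite subr_eq0 => /eqP /(congr1 Num.conj).
  rewrite !rmorphD !rmorphM fmorphV /= !conjCK !r_conj => E.
  apply: (mulfI (r_neq0 i)); apply: (mulIf (r_neq0 j)).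
  have ri0 := r_neq0 i; have rj0 := r_neq0 j.
  transitivity (r i * r i * L i j + (L j i)^*%R * (r j * r j)).
    by field; rewrite ri0 rj0.
  by rewrite E; ring.
pose v i := u i 0.
have T_lyap i j : T i j + (T j i)^*%R = v i * (v j)^*%R.
  have := congr1 (fun X => U *m X *m U^t*) M_lyap.
  rewrite mulmxDr mulmxDl => /matrixP/(_ i j).
  rewrite mulmxA -(mulmxA (U *m w)) -map_mxM -trmx_mul.
  have -> : U *m M^t* *m U^t* = T^t*.
    by rewrite defT -mulmxA !trmx_mul !map_mxM trmxCK.
  by rewrite -defT -defu !mxE big_ord1 !mxE.
have v_sqr k : v k * (v k)^*%R = (2 * complex.Re (mu k))%:C.
  by rewrite -T_lyap T_diag rmorphM rmorph_nat -addcJ.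
have v_neq0 i : v i != 0.
  apply/eqP=> vi0; have /eqP := v_sqr i; rewrite vi0 mul0r eq_sym.
  by rewrite (fmorph_eq0 (real_complex R)) mulf_eq0 pnatr_eq0 /= gt_eqF.
(* Below the diagonal both sides equal the conjugate of [v j], which is [2 * Re (mu j) / v j] by
   [v_sqr]. *)
have T_dirk i j : (v i)^-1 * T i j = dirk_matrix mu i j * (v j)^-1.
  rewrite mxE; case: eqVneq => [<-|ij]; first by rewrite T_diag mulrC.
  case: ltnP => [ji|ij'].
    have T0 : T j i = 0 by apply: (is_trig_mxP T_trig).
    move: (T_lyap i j); rewrite T0 rmorph0 addr0 => ->.
    by rewrite mulKf // -v_sqr mulrAC mulfV // mul1r.
  have T0 : T i j = 0.
    by apply: (is_trig_mxP T_trig); rewrite ltn_neqAle ij' andbT.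
  by rewrite T0 mulr0 mul0r.
pose V := diag_mx (\row_i (v i)^-1).
have VT : V *m T = dirk_matrix mu *m V.
  apply/matrixP=> i j; rewrite mul_diag_mx mul_mx_diag [LHS]mxE [RHS]mxE.
  by rewrite ![(\row__ _) _ _]mxE T_dirk.
exists (V *m U *m W); split.
- rewrite !unitmx_mul W_unit (unitarymx_unit U_unitary) !andbT.
  by apply: diag_mx_unit => j; rewrite mxE invr_eq0.
- rewrite -(mulmxA _ W) -MW !mulmxA -VT defT.
  by rewrite -(mulmxA V _ U) UKtV mulmxA.
- rewrite -!mulmxA; have -> : W *m const_mx 1 = w.
    by apply/matrixP => i j; rewrite mul_diag_mx !mxE mulr1.
  by apply/matrixP => i j; rewrite -defu mul_diag_mx !mxE (ord1 j) mulVf.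
- have conj_tr (X : 'M[R[i]]_s) : (conjmatrix X)^T = X^t* by rewrite map_trmx.
  rewrite conj_tr !trmx_mul !map_mxM !mulmxA.
  have Wc : W^t* = W.
    apply/matrixP=> i j; rewrite !mxE eq_sym; case: eqP => [->|]; rewrite ?conjC0 //.
    by rewrite !mulr1n.
  pose D := diag_mx (cplxmx (dirk_weights mu))^T.
  have VDV : V^t* *m D *m V = 1%:M.
    apply/matrixP=> i j.
    rewrite tr_diag_mx map_diag_mx mul_diag_mx mul_mx_diag !mxE.
    case: eqP => [<-|]; rewrite ?mulr0n ?mulr0 ?mul0r //= !mulr1n.
    by rewrite -v_sqr fmorphV (mulrC (v i)) mulKf ?conjC_eq0 // mulfV.
  transitivity (W *m U^t* *m (V^t* *m D *m V) *m U *m W).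
    by rewrite Wc !mulmxA.
  rewrite VDV mulmx1 UKtV.
  by apply/matrixP=> i j; rewrite mul_diag_mx !mxE mulrnAr r_sqr.
Qed.

(** * Solvability of the stages and change of basis among them *)

(** A left kernel vector would be an eigenvector of [A] for [a^-1], whose real part has the sign of
    that of [a]. *)
Lemma stable_shift_unit (R : realType) (n : nat) (A : 'M[R]_n) (a : R[i]) :
  stable A -> 0 < complex.Re a -> 1%:M - a *: cplxmx A \in unitmx.
Proof.
move=> A_stable a_gt0; rewrite -row_free_unit -kermx_eq0; apply/negPn/negP.
case/rowV0Pn=> v /sub_kermxP; rewrite mulmxBr mulmx1 -scalemxAr => /eqP.
rewrite subr_eq0 => /eqP vE v_neq0.
have a_neq0 : a != 0 by apply: contraTneq a_gt0 => ->; rewrite ltxx.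
have /A_stable : eigenvalue (cplxmx A) a^-1.
  by apply/eigenvalueP; exists v => //; rewrite {2}vE scalerK.
apply/negP; rewrite -leNgt.
case: a a_gt0 {a_neq0 vE} => x y /= x_gt0.
by rewrite divr_ge0 ?addr_ge0 ?sqr_ge0 // ltW.
Qed.

Section Steps.
Variables (R : realType) (n : nat) (A : 'M[R[i]]_n).

Lemma repeat_colE (s : nat) (v : 'cV[R[i]]_n) :
  repeat_col s v = v *m (const_mx 1 : 'rV_s).
Proof. by apply/matrixP=> i j; rewrite !mxE big_ord1 mxE mulr1. Qed.

Lemma rk_step_fun (s : nat) (L : 'M[R[i]]_s) (beta : 'cV[R]_s)
    (h0 h h' : 'cV[R[i]]_n) Z Z' :
  rk_step A L beta h0 Z h -> rk_step A L beta h0 Z' h' -> Z = Z' /\ h = h'.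
Proof. by move=> [K [[_ KE] -> ->]] [K' [[/KE <- _] -> ->]]. Qed.

Lemma weighted_gram (s : nat) (H : 'M[R[i]]_(n, s)) (beta : 'cV[R]_s) :
  (forall j, 0 < beta j 0) ->
  let Z := H *m diag_mx (\row_j (Num.sqrt (beta j 0))%:C) in
  Z *m (conjmatrix Z)^T = H *m diag_mx (cplxmx beta)^T *m (conjmatrix H)^T.
Proof.
move=> beta_gt0 /=; apply/matrixP=> i j; rewrite !mul_mx_diag !mxE.
apply: eq_bigr => k _; rewrite !mxE.
have <- : (Num.sqrt (beta k 0))%:C * (Num.sqrt (beta k 0))%:C = (beta k 0)%:C.
  by rewrite -rmorphM -expr2 sqr_sqrtr // ltW.
have := conjc_real (Num.sqrt (beta k 0)).
rewrite (rmorphM conjc); move: (_%:C) => t /= ->.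
by rewrite mulrACA mulrAC.
Qed.

(** The bijection sending [K] to [K *m S^T] carries the stage equation of [L] to that of [L'], so
    existence and uniqueness of the stages transfer together. *)
Lemma rk_step_change_basis (s : nat) (L L' S : 'M[R[i]]_s) (beta beta' : 'cV[R]_s)
    (h0 h : 'cV[R[i]]_n) (Z' : 'M[R[i]]_(n, s)) :
  (forall j, 0 < beta j 0) -> (forall j, 0 < beta' j 0) ->
  S \in unitmx -> S *m L = L' *m S ->
  S *m (const_mx 1 : 'cV_s) = const_mx 1 ->
  (conjmatrix S)^T *m diag_mx (cplxmx beta')^T *m S = diag_mx (cplxmx beta)^T ->
  rk_step A L' beta' h0 Z' h ->
  exists2 Z, rk_step A L beta h0 Z h
    & Z *m (conjmatrix Z)^T = Z' *m (conjmatrix Z')^T.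
Proof.
move=> beta_gt0 beta'_gt0 S_unit SL S1 SDS [K' [[K'E K'uniq] -> ->]].
have St_unit : S^T \in unitmx by rewrite unitmx_tr.
(* A repeated column is [v] times the all-ones row, which [S^T] fixes. *)
have repS (v : 'cV[R[i]]_n) : repeat_col s v *m S^T = repeat_col s v.
  rewrite !repeat_colE -mulmxA; congr (_ *m _).
  by rewrite -[LHS]trmxK trmx_mul trmxK trmx_const S1 trmx_const.
have SLt : S^T *m L'^T = L^T *m S^T by rewrite -!trmx_mul SL.
have SDSt : S^T *m diag_mx (cplxmx beta')^T *m conjmatrix S = diag_mx (cplxmx beta)^T.
  by rewrite -[RHS]tr_diag_mx -SDS !trmx_mul trmxK tr_diag_mx mulmxA.
have stageS (K : 'M[R[i]]_(n, s)) v :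
    (v + A *m K *m L^T) *m S^T = v *m S^T + A *m (K *m S^T) *m L'^T.
  by rewrite mulmxDl -!mulmxA SLt.
have stagesS K : K = repeat_col s (A *m h0) + A *m K *m L^T <->
    K *m S^T = repeat_col s (A *m h0) + A *m (K *m S^T) *m L'^T.
  split=> [{1}->|E]; first by rewrite stageS repS.
  by apply: (can_inj (mulmxK St_unit)); rewrite stageS repS.
pose K := K' *m invmx S^T.
have KS : K *m S^T = K' by rewrite mulmxKV.
have D1 (b : 'cV[R]_s) : diag_mx (cplxmx b)^T *m const_mx 1 = cplxmx b.
  by apply/matrixP=> i j; rewrite mul_diag_mx !mxE mulr1 (ord1 j).
(* Write each weight vector as its diagonal matrix times the all-ones vector; [SDSt] applies, and
   [conjmatrix S] also fixes that vector. *)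
have KB : K *m cplxmx beta = K' *m cplxmx beta'.
  have S1c : conjmatrix S *m (const_mx 1 : 'cV_s) = const_mx 1.
    have := congr1 (@conjmatrix R s 1) S1.
    by rewrite /conjmatrix map_mxM !map_const_mx rmorph1.
  by rewrite -KS -(D1 beta) -SDSt -!mulmxA S1c D1.
exists ((repeat_col s h0 + K *m L^T) *m diag_mx (\row_j (Num.sqrt (beta j 0))%:C)).
  exists K; split=> //; last by rewrite KB.
  split=> [|K1 /stagesS /K'uniq E]; first by apply/stagesS; rewrite KS.
  by rewrite /K E mulmxK.
rewrite (weighted_gram _ beta_gt0) (weighted_gram _ beta'_gt0).
(* The stage values also differ by [S^T], which [SDSt] absorbs into the weights of the Gram
   matrix. *)
have -> : repeat_col s h0 + K' *m L'^T = (repeat_col s h0 + K *m L^T) *m S^T.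
  by rewrite mulmxDl repS -KS -!mulmxA SLt.
set H := _ + _.
by rewrite -SDSt /conjmatrix map_mxM trmx_mul !map_trmx trmxK !mulmxA.
Qed.

End Steps.

(** * The DIRK step as a succession of one-stage steps *)

Section OneStage.
Variables (R : realType) (n s : nat) (A : 'M[R[i]]_n) (mu : 'I_s -> R[i]).

(** The vector reached after [j] one-stage steps when the columns of [K] are their stages. *)
Definition partial_vector (h0 : 'cV[R[i]]_n) (K : 'M[R[i]]_(n, s)) (j : nat) :=
  h0 + \sum_(l < s | (l < j)%N) (2 * complex.Re (mu l))%:C *: col l K.

Lemma col_mul_dirk (K : 'M[R[i]]_(n, s)) (j : 'I_s) :
  col j (K *m (dirk_matrix mu)^T)
  = \sum_(l < s | (l < j)%N) (2 * complex.Re (mu l))%:C *: col l K + mu j *: col j K.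
Proof.
apply/matrixP=> i k; rewrite !mxE summxE (bigD1 j) //= !mxE eqxx addrC mulrC.
congr (_ + _); rewrite big_mkcond [RHS]big_mkcond; apply: eq_bigr => l _ /=.
rewrite !mxE eq_sym; case: eqVneq => [->|lj] /=; first by rewrite ltnn.
by case: ltnP => _; rewrite ?mxE ?mulr0 // mulrC.
Qed.

(** Column [j] of the stage equation involves only columns up to [j]. Moving the diagonal term to
    the left gives the one-stage equation started at the partial vector. *)
Lemma dirk_stagesP (h0 : 'cV[R[i]]_n) (K : 'M[R[i]]_(n, s)) :
  K = repeat_col s (A *m h0) + A *m K *m (dirk_matrix mu)^T <->
  forall j, (1%:M - mu j *: A) *m col j K = A *m partial_vector h0 K j.
Proof.
have repE j : col j (repeat_col s (A *m h0)) = A *m h0.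
  by apply/matrixP=> i k; rewrite ord1 !mxE.
have colE j : (1%:M - mu j *: A) *m col j K = A *m partial_vector h0 K j <->
    col j K = col j (repeat_col s (A *m h0) + A *m K *m (dirk_matrix mu)^T).
  rewrite mulmxBl mul1mx -scalemxAl (raddfD (col j)) /= repE -mulmxA.
  rewrite [col j (A *m _)]colE -mulmxA -colE col_mul_dirk.
  rewrite /partial_vector !mulmxDr -scalemxAr addrA.
  by split=> [/eqP|/eqP]; [rewrite subr_eq => /eqP|rewrite -subr_eq => /eqP].
split=> [KE j|KE]; first by apply/colE; rewrite -KE.
by apply/matrixP=> i j; have /colE/matrixP/(_ i 0) := KE j; rewrite !mxE.
Qed.

Hypothesis mu_unit : forall j, 1%:M - mu j *: A \in unitmx.

(** Forward substitution, by strong induction on the column index. *)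
Lemma dirk_stages_unique (h0 : 'cV[R[i]]_n) (K K' : 'M[R[i]]_(n, s)) :
  K = repeat_col s (A *m h0) + A *m K *m (dirk_matrix mu)^T ->
  K' = repeat_col s (A *m h0) + A *m K' *m (dirk_matrix mu)^T -> K = K'.
Proof.
move=> /dirk_stagesP KE /dirk_stagesP K'E.
suff colE m (j : 'I_s) : j = m :> nat -> col j K = col j K'.
  by apply/matrixP=> i j; have /matrixP/(_ i 0) := colE j j erefl; rewrite !mxE.
elim/ltn_ind: m j => m IHm j jm.
apply: (can_inj (mulKmx (mu_unit j))); rewrite KE K'E; congr (_ *m (_ + _)).
by apply: eq_bigr => l lj; rewrite (IHm l) // -jm.
Qed.

Lemma one_stage_iteration_dirk (h0 h : 'cV[R[i]]_n) (Z : 'M[R[i]]_(n, s)) :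
  rk_one_stage_iteration A mu h0 Z h ->
  rk_step A (dirk_matrix mu) (dirk_weights mu) h0 Z h.
Proof.
case=> Zs [hs [hs0 steps -> ->]].
(* Solving for each stage explicitly replaces the existential ones, so that they can be collected as
   the columns of one [K]. *)
pose k j := invmx (1%:M - mu j *: A) *m (A *m hs j).
have kE j : (1%:M - mu j *: A) *m k j = A *m hs j by rewrite mulKVmx.
have {}steps (j : 'I_s) : Zs j.+1 = castmx (erefl n, addn1 j) (row_mx (Zs j)
      ((Num.sqrt (2 * complex.Re (mu j)))%:C *: (hs j + mu j *: k j))) /\
    hs j.+1 = hs j + (2 * complex.Re (mu j))%:C *: k j.
  have [z [[K [[KE _] zE hE]] ZE]] := steps j.
  by have Kk : K = k j; [rewrite /k -KE mulKmx | rewrite ZE zE hE Kk].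
pose K := \matrix_(i, j) k j i 0.
have colK j : col j K = k j by apply/matrixP=> i l; rewrite ord1 !mxE.
have hsE m : (m <= s)%N -> hs m = partial_vector h0 K m.
  elim: m => [|m IHm] ms; first by rewrite /partial_vector big_pred0 ?addr0.
  rewrite (steps (Ordinal ms)).2 /= IHm ?(ltnW ms) // /partial_vector -addrA.
  congr (_ + _); rewrite addrC [RHS](bigD1 (Ordinal ms)) //= colK; congr (_ + _).
  apply: eq_bigl => l; rewrite ltnS ltn_neqAle andbC; congr (_ && _).
have KE : K = repeat_col s (A *m h0) + A *m K *m (dirk_matrix mu)^T.
  by apply/dirk_stagesP => j; rewrite colK kE hsE // ltnW.
exists K; split.
- by split=> // K' K'E; apply: dirk_stages_unique K'E.
(* Column [l] is appended at step [l] and kept afterwards. In the induction [ord_max] is the new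
   column, and lifting past it leaves the older indices unchanged. *)
- have ZsE m (ms : (m <= s)%N) i (l : 'I_m) :
    Zs m i l = ((Num.sqrt (2 * complex.Re (mu (widen_ord ms l))))%:C *:
      (hs l + mu (widen_ord ms l) *: k (widen_ord ms l))) i 0.
    elim: m ms l => [|m IHm] ms l; first by case: l.
    rewrite (steps (Ordinal ms)).1 castmxE /=.
    case: (unliftP ord_max l) => [l'|] ->.
      rewrite (_ : cast_ord _ _ = lshift 1 l'); last first.
        by apply: val_inj; rewrite /= /bump leqNgt ltn_ord.
      rewrite row_mxEl cast_ord_id (IHm (ltnW ms)).
      rewrite (_ : widen_ord ms _ = widen_ord (ltnW ms) l') /=.
        by rewrite /bump leqNgt ltn_ord.
      by apply: val_inj; rewrite /= /bump leqNgt ltn_ord.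
    rewrite (_ : cast_ord _ _ = rshift m 0); last by apply: val_inj; rewrite /= addn0.
    rewrite row_mxEr cast_ord_id (_ : widen_ord ms _ = Ordinal ms) //.
    exact: val_inj.
  apply/matrixP=> i j; rewrite (ZsE s (leqnn s)) mul_mx_diag.
  have -> : widen_ord (leqnn s) j = j by apply: val_inj.
  rewrite [RHS]mxE [in RHS]mxE mxE mulrC.
  have /matrixP/(_ i 0) := col_mul_dirk K j; rewrite [LHS]mxE => ->.
  rewrite hsE ?(ltnW (ltn_ord j)) // /partial_vector colK [(\row__ _) _ _]mxE.
  by rewrite -addrA [(h0 + _) i 0]mxE [repeat_col _ _ _ _]mxE [dirk_weights _ _ _]mxE.
- rewrite hsE // /partial_vector; congr (_ + _); apply/matrixP=> i j.
  rewrite summxE mxE; apply: eq_big => [l|l _]; first exact: ltn_ord.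
  by rewrite !mxE mulrC.
Qed.

End OneStage.

Lemma one_stage_iteration_exists (R : realType) (n s : nat) (A : 'M[R[i]]_n)
    (mu : 'I_s -> R[i]) (h0 : 'cV[R[i]]_n) :
  (forall j, 1%:M - mu j *: A \in unitmx) ->
  exists Z h, rk_one_stage_iteration A mu h0 Z h.
Proof.
(* The sequences run over all naturals, so [mu] is extended by 0 from [s] on; only indices below [s]
   are constrained. *)
move=> mu_unit; pose m k := oapp mu 0 (insub k).
have mE (j : 'I_s) : m j = mu j by rewrite /m valK.
pose K c (h : 'cV[R[i]]_n) := invmx (1%:M - c *: A) *m (A *m h).
pose hs := nat_rect _ h0 (fun k h => h + (2 * complex.Re (m k))%:C *: K (m k) h).
pose z k := (Num.sqrt (2 * complex.Re (m k)))%:C *: (hs k + m k *: K (m k) (hs k)).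
pose Zs := nat_rect (fun k => 'M[R[i]]_(n, k)) 0
  (fun k Z => castmx (erefl n, addn1 k) (row_mx Z (z k))).
exists (Zs s), (hs s), Zs, hs; split=> // j; exists (z j); split=> //.
exists (K (mu j) (hs j)); split; rewrite /z /= ?mE //.
by split=> [|K' K'E]; rewrite /K; [rewrite mulKVmx | rewrite -K'E mulKmx].
Qed.

Lemma rk_step_one_stage (R : realType) (n : nat) (A : 'M[R[i]]_n) (c : R[i])
    (h0 z h : 'cV[R[i]]_n) :
  rk_step A (c%:M : 'M_1) (const_mx (2 * complex.Re c)) h0 z h <->
  exists K : 'cV[R[i]]_n,
    [/\ unique (fun K => (1%:M - c *: A) *m K = A *m h0) K,
        z = (Num.sqrt (2 * complex.Re c))%:C *: (h0 + c *: K)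
      & h = h0 + (2 * complex.Re c)%:C *: K].
Proof.
have rep1 (v : 'cV[R[i]]_n) : repeat_col 1 v = v.
  by apply/matrixP=> i j; rewrite mxE (ord1 j).
have stageE (K : 'cV[R[i]]_n) :
    (K = repeat_col 1 (A *m h0) + A *m K *m (c%:M)^T) <->
    ((1%:M - c *: A) *m K = A *m h0).
  rewrite rep1 tr_scalar_mx mul_mx_scalar mulmxBl mul1mx -scalemxAl.
  by split=> [/eqP|/eqP]; [rewrite -subr_eq => /eqP|rewrite subr_eq => /eqP].
have weightE (K : 'cV[R[i]]_n) (d : R) :
    K *m (cplxmx (const_mx d : 'cV_1)) = d%:C *: K.
  by rewrite [cplxmx _]mx11_scalar mul_mx_scalar !mxE.
have factorE (K : 'cV[R[i]]_n) (d : R) :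
    (repeat_col 1 h0 + K *m (c%:M)^T)
      *m diag_mx (\row_j (Num.sqrt ((const_mx d : 'cV_1) j 0))%:C)
    = (Num.sqrt d)%:C *: (h0 + c *: K).
  rewrite rep1 tr_scalar_mx mul_mx_scalar [diag_mx _]mx11_scalar mul_mx_scalar.
  by rewrite !mxE.
by split=> -[K [[KE KU] -> ->]]; exists K; rewrite weightE factorE; split=> //;
  split=> [|K' /stageE]; [apply/stageE|apply: KU|apply/stageE|apply: KU].
Qed.

Lemma one_stage_stepsP (R : realType) (n s : nat) (A : 'M[R[i]]_n)
    (mu : 'I_s -> R[i]) (h0 h : 'cV[R[i]]_n) (Z : 'M[R[i]]_(n, s)) :
  rk_one_stage_steps A mu h0 Z h <-> rk_one_stage_iteration A mu h0 Z h.
Proof.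
by split=> -[Zs [hs [hs0 steps -> ->]]]; exists Zs, hs; split=> // j;
  have [z [zE ZE]] := steps j; exists z; split=> //; apply/rk_step_one_stage.
Qed.

(** A common form for the three equivalences: outputs of [Q] are DIRK outputs, the change of basis
    turns each into an output for [L], and a step has at most one output. *)
Lemma equivalent_to_dirk (R : realType) (n s : nat) (A : 'M[R[i]]_n) (L : 'M[R[i]]_s)
    (beta : 'cV[R]_s) (mu : 'I_s -> R[i]) (S : 'M[R[i]]_s) (h0 : 'cV[R[i]]_n)
    (Q : 'M[R[i]]_(n, s) -> 'cV[R[i]]_n -> Prop) :
  (forall j, 0 < beta j 0) -> (forall j, 0 < complex.Re (mu j)) ->
  S \in unitmx -> S *m L = dirk_matrix mu *m S ->
  S *m (const_mx 1 : 'cV_s) = const_mx 1 ->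
  (conjmatrix S)^T *m diag_mx (cplxmx (dirk_weights mu))^T *m S
    = diag_mx (cplxmx beta)^T ->
  (exists Z h, Q Z h) ->
  (forall Z h, Q Z h -> rk_step A (dirk_matrix mu) (dirk_weights mu) h0 Z h) ->
  equivalent_procedures (rk_step A L beta h0) Q.
Proof.
move=> beta_gt0 mu_gt0 S_unit SL S1 SDS exQ Q_dirk.
have w_gt0 j : 0 < dirk_weights mu j 0 by rewrite mxE mulr_gt0 // ltr0n.
have Q_rk Z h (QZ : Q Z h) :=
  rk_step_change_basis beta_gt0 w_gt0 S_unit SL S1 SDS (Q_dirk Z h QZ).
split=> //; first by have [Z [h /Q_rk[Z' Z'P _]]] := exQ; exists Z', h.
by move=> Z h Z' h' ZP /Q_rk[Z'' /(rk_step_fun ZP)[<- <-] ->].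
Qed.

(** * Similarity of a tableau matrix to its transpose, and the first claim *)

(** Reversing rows and columns of the reversed DIRK matrix gives an upper triangular matrix with
    [2 * Re (mu j)] at [(i, j)], where the transpose has [2 * Re (mu i)]. Conjugation by [W]
    exchanges the two. *)
Lemma dirk_matrix_tr_similar (R : realType) (s : nat) (mu : 'I_s -> R[i]) :
  (forall j, 0 < complex.Re (mu j)) ->
  exists2 G : 'M[R[i]]_s, G \in unitmx
    & G *m dirk_matrix (mu \o @rev_ord s) = (dirk_matrix mu)^T *m G.
Proof.
move=> mu_gt0; pose W := diag_mx (\row_j (2 * complex.Re (mu j))%:C).
pose J : 'M[R[i]]_s := rowsub (@rev_ord s) 1%:M.
have JE : J = colsub (@rev_ord s) 1%:M.
  by apply/matrixP=> i j; rewrite !mxE (can2_eq (@rev_ordK s) (@rev_ordK s)).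
have JJ : J *m J = 1%:M.
  rewrite {2}JE mulmx_colsub mulmx1.
  by apply/matrixP=> i j; rewrite !mxE (inj_eq rev_ord_inj).
exists (W *m J).
  rewrite unitmx_mul (mulmx1_unit JJ).1 andbT; apply: diag_mx_unit => j.
  by rewrite mxE (fmorph_eq0 (real_complex R)) mulf_neq0 ?pnatr_eq0 ?gt_eqF.
rewrite -mulmxA mul_rowsub_mx mul1mx JE !mulmx_colsub mulmx1.
apply/matrixP=> i j; rewrite mul_diag_mx mxE [RHS]mxE mul_mx_diag !mxE.
rewrite /= rev_ordK (can2_eq (@rev_ordK s) (@rev_ordK s)) (eq_sym (rev_ord j)).
case: eqVneq => [->|_]; first by rewrite mulrC.
have -> : (j < s - i.+1)%N = (i < s - j.+1)%N by lia.
by case: ifP => _; rewrite ?mulr0 ?mul0r // mulrC.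
Qed.

Lemma rk_tableau_similar (R : realType) (s : nat) (L S S' : 'M[R[i]]_s) (beta : 'cV[R]_s)
    (mu : 'I_s -> R[i]) :
  (forall j, 0 < beta j 0) -> (forall j, 0 < complex.Re (mu j)) ->
  diag_mx (cplxmx beta)^T *m conjmatrix L + L^T *m diag_mx (cplxmx beta)^T
    - cplxmx beta *m (cplxmx beta)^T = 0 ->
  S \in unitmx -> S *m L = dirk_matrix mu *m S ->
  S' \in unitmx -> S' *m L = dirk_matrix (mu \o @rev_ord s) *m S' ->
  similar_in unitmx (- conjmatrix L) (L - const_mx 1 *m (cplxmx beta)^T).
Proof.
move=> beta_gt0 mu_gt0 L_beta S_unit SL S'_unit S'L.
have [G G_unit GE] := dirk_matrix_tr_similar mu_gt0.
(* The chain runs from [L] through the reversed DIRK matrix and the transposed DIRK matrix to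
   [L^T]. *)
pose X := S^T *m G *m S'.
have X_unit : X \in unitmx by rewrite !unitmx_mul unitmx_tr S_unit G_unit.
have XL : X *m L = L^T *m X.
  rewrite /X -mulmxA S'L !mulmxA -(mulmxA _ G) GE !mulmxA.
  by rewrite -[S^T *m _]trmx_mul -SL trmx_mul.
set D := diag_mx (cplxmx beta)^T in L_beta *.
have D_unit : D \in unitmx.
  by apply: diag_mx_unit => j; rewrite !mxE (fmorph_eq0 (real_complex R)) gt_eqF.
have DL : D *m (L - const_mx 1 *m (cplxmx beta)^T) = - (conjmatrix L)^T *m D.
  rewrite mulmxBr mulmxA (_ : D *m const_mx 1 = cplxmx beta); last first.
    by apply/matrixP=> i j; rewrite mul_diag_mx !mxE mulr1 (ord1 j).
  apply/eqP; rewrite mulNmx -subr_eq0 opprK addrAC addrC.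
  have := congr1 trmx L_beta.
  rewrite linearB linearD /= !trmx_mul !trmxK tr_diag_mx trmx0 => LB.
  by rewrite -[X in _ == X]LB -/D addrC [D *m L + _]addrC.
(* [conjmatrix X] takes [conjmatrix L] to its transpose, and [invmx D] takes minus that transpose to
   the target, by [DL]. *)
exists (invmx D *m conjmatrix X).
  by rewrite unitmx_mul unitmx_inv D_unit map_unitmx.
apply/similarP.
  by rewrite unitmx_mul unitmx_inv D_unit map_unitmx.
apply: (can_inj (mulKmx D_unit)); rewrite [RHS]mulmxA DL.
rewrite -!mulmxA !mulKVmx // mulmxN mulNmx; congr (- _).
by rewrite -!map_mxM XL map_mxM map_trmx.
Qed.

Theorem theorem5 (R : realType) (n s : nat) (A : 'M[R]_n) (b : 'cV[R]_n)
    (L : 'M[R[i]]_s) (beta : 'cV[R]_s) (mu : 'I_s -> R[i])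
    (A_stable : stable A)
    (beta_gt0 : forall j, 0 < beta j 0)
    (L_beta : diag_mx (cplxmx beta)^T *m conjmatrix L
              + L^T *m diag_mx (cplxmx beta)^T
              - cplxmx beta *m (cplxmx beta)^T = 0)
    (mu_spec : char_poly L = \prod_(j < s) ('X - (mu j)%:P))
    (mu_gt0 : forall j, 0 < complex.Re (mu j)) :
  [/\ similar_in unitmx (- conjmatrix L) (L - const_mx 1 *m (cplxmx beta)^T),
      equivalent_procedures
        (rk_step (cplxmx A) L beta (cplxmx b))
        (rk_step (cplxmx A) (dirk_matrix mu) (dirk_weights mu) (cplxmx b)),
      equivalent_procedures
        (rk_step (cplxmx A) L beta (cplxmx b))
        (rk_one_stage_steps (cplxmx A) mu (cplxmx b))
    & equivalent_procedures
        (rk_step (cplxmx A) L beta (cplxmx b))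
        (rk_one_stage_iteration (cplxmx A) mu (cplxmx b))].
Proof.
have [S [S_unit SL S1 SDS]] := dirk_similarity beta_gt0 L_beta mu_spec mu_gt0.
(* The reversed list has the same product, so the similarity result applies to it as well. *)
have mu_spec' : char_poly L = \prod_j ('X - ((mu \o @rev_ord s) j)%:P).
  by rewrite mu_spec (reindex_inj (@rev_ord_inj s)).
have [S' [S'_unit S'L _ _]] :=
  dirk_similarity beta_gt0 L_beta mu_spec' (fun j => mu_gt0 (rev_ord j)).
have mu_unit j : 1%:M - mu j *: cplxmx A \in unitmx.
  exact: stable_shift_unit (mu_gt0 j).
have [Z [h it]] := one_stage_iteration_exists (cplxmx b) mu_unit.
have equivP := equivalent_to_dirk beta_gt0 mu_gt0 S_unit SL S1 SDS.
split.
- exact: rk_tableau_similar SL S'_unit S'L.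
- by apply: equivP => //; exists Z, h; apply: one_stage_iteration_dirk.
- apply: equivP => [|Z' h' /one_stage_stepsP]; last exact: one_stage_iteration_dirk.
  by exists Z, h; apply/one_stage_stepsP.
- apply: equivP => [|Z' h']; last exact: one_stage_iteration_dirk.
  by exists Z, h.
Qed.
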